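(* Let $d\ge 1$ and let $v=(v_1,\dots,v_d)^T:\mathbb{R}^d\to\mathbb{R}^d$ be a twice continuously differentiable map such that $I+\nabla v^T(x)$ is invertible for all $x\in\mathbb{R}^d$. Then $$\nabla_x^T\left[\,|I+\nabla v^T|\,(I+\nabla v^T)^{-T}\right]\equiv 0 .$$
   Context: $\nabla v^T$ is the $d\times d$ matrix with $(i,j)$ entry $\partial v_j/\partial x_i$; $I$ is the $d\times d$ identity matrix; $|A|$ is the determinant of $A$; $A^{-T}=(A^{-1})^T$. For a $d\times d$ matrix-valued function $A$, $\nabla_x^T[A]$ denotes the row vector obtained by multiplying the row operator $(\partial/\partial x_1,\dots,\partial/\partial x_d)$ with $A$, i.e. its $j$-th entry is $\sum_{i=1}^d\partial A_{ij}/\partial x_i$. *)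

(* Defs.v *)
From mathcomp Require Import all_boot all_order all_algebra.
From mathcomp Require Import all_classical all_reals all_analysis.

Set Implicit Arguments.
Unset Strict Implicit.
Unset Printing Implicit Defensive.

Import numFieldNormedType.Exports.
Local Open Scope ring_scope.
Local Open Scope classical_set_scope.

Section Defs.
Variables (R : realType) (d : nat).

Definition partial (i : 'I_d) (f : 'cV[R]_d -> R) : 'cV[R]_d -> R :=
  'D_(delta_mx i 0) f.

Definition has_partial (i : 'I_d) (f : 'cV[R]_d -> R) (x : 'cV[R]_d) : Prop :=
  derivable f x (delta_mx i 0).

(* C^k: the partial derivatives of order at most k all exist on R^d and are
   continuous there.  The existence clause is needed because [partial] is a
   total operator, with a junk value where the limit does not exist. *)
Fixpoint classC (k : nat) (f : 'cV[R]_d -> R) : Prop :=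
  continuous f /\
  if k is k'.+1 then
    forall i : 'I_d, (forall x, has_partial i f x) /\ classC k' (partial i f)
  else True.

Definition classCv (k : nat) (v : 'cV[R]_d -> 'cV[R]_d) : Prop :=
  forall j : 'I_d, classC k (fun x => v x j 0).

(* The transpose of the usual Jacobian matrix: i indexes the variable and j
   the component. *)
Definition nablaT (v : 'cV[R]_d -> 'cV[R]_d) (x : 'cV[R]_d) : 'M[R]_d :=
  \matrix_(i, j) partial i (fun y => v y j 0) x.

Definition row_nabla (A : 'cV[R]_d -> 'M[R]_d) (x : 'cV[R]_d) : 'rV[R]_d :=
  \row_j \sum_(i < d) partial i (fun y => A y i j) x.

Definition row_nabla_defined (A : 'cV[R]_d -> 'M[R]_d) (x : 'cV[R]_d) : Prop :=
  forall i j : 'I_d, has_partial i (fun y => A y i j) x.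

End Defs.

(* Main.v *)
(** With [M = I + nabla v^T], the matrix [|M| M^{-T}] is the cofactor matrix of
    [M], and the [(i, j)] cofactor is the determinant of [M] with row [i]
    replaced by [e_j].  Differentiating row by row, the [j]-th entry of the
    divergence is the sum over [i <> k] of the determinants of [M] with row [i]
    replaced by [e_j] and row [k] by [d_i d_k (x + v)].  By the symmetry of
    second derivatives, exchanging [i] and [k] amounts to exchanging two rows,
    so the terms cancel in pairs. *)

Require Import Defs.
From mathcomp Require Import all_boot all_order all_algebra.
From mathcomp Require Import all_classical all_reals all_analysis.
From mathcomp Require Import perm ring.

Set Implicit Arguments.
Unset Strict Implicit.
Unset Printing Implicit Defensive.

Import Order.TTheory GRing.Theory Num.Theory.
Import numFieldNormedType.Exports.
Local Open Scope ring_scope.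

(** * Symmetry of mixed second derivatives along two directions *)

Section Schwarz.
Context {R : realType} {V : normedModType R}.
Implicit Types (f : V -> R) (a b x : V).

Lemma is_derive_line f x a (s : R) : derivable f (x + s *: a) a ->
  is_derive s 1 (fun t : R => f (x + t *: a)) ('D_a f (x + s *: a)).
Proof.
move=> fa.
have E : (fun h : R => h^-1 *: (((fun t : R => f (x + t *: a)) \o shift s)
    (h *: (1 : R)) - f (x + s *: a))) =
  (fun h : R => h^-1 *: ((f \o shift (x + s *: a)) (h *: a) - f (x + s *: a))).
  apply/funext => h /=; congr (_ *: (f _ - _)).
  by rewrite /= scalerDl [h *: (1 : R)]mulr1 addrCA.
by split; rewrite /derivable /derive E.
Qed.

Lemma MVT_everywhere (g dg : R -> R) (h : R) : 0 < h ->
  (forall t : R, is_derive t 1 g (dg t)) ->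
  exists2 s, 0 < s < h & g h - g 0 = dg s * h.
Proof.
move=> h0 gd.
have [|s sh] := @MVT R g dg 0 h h0 (fun t _ => gd t).
  apply: continuous_subspaceT => t.
  exact/differentiable_continuous/derivable1_diffP/(@ex_derive _ _ _ _ _ _ _ (gd t)).
by rewrite subr0 => E; exists s.
Qed.

(** The left side is the second difference of [f], which is symmetric in [a] and [b]. The mean value
    theorem is used twice: along [a] for the increment of [f] by [h *: b], then along [b] for
    ['D_a f]. *)
Lemma MVT_mixed f a b x (h : R) : 0 < h ->
  (forall y, derivable f y a) -> (forall y, derivable ('D_a f) y b) ->
  exists s t, [/\ 0 < s < h, 0 < t < h &
    f (x + h *: a + h *: b) - f (x + h *: a) - f (x + h *: b) + f x =
    'D_b ('D_a f) (x + s *: a + t *: b) * h * h].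
Proof.
move=> h0 fa fab.
pose g (t : R) := f (x + h *: b + t *: a) - f (x + t *: a).
have gd (t : R) : is_derive t 1 g
    ('D_a f (x + h *: b + t *: a) - 'D_a f (x + t *: a)).
  by apply: is_deriveB; apply: is_derive_line.
have [s sh Es] := MVT_everywhere h0 gd.
pose k (t : R) := 'D_a f (x + s *: a + t *: b).
have kd (t : R) : is_derive t 1 k ('D_b ('D_a f) (x + s *: a + t *: b)).
  exact: is_derive_line.
have [t th Et] := MVT_everywhere h0 kd.
exists s, t; split => //; rewrite -Et /k scale0r addr0.
rewrite (addrAC x (s *: a)) -Es /g scale0r !addr0 (addrAC x (h *: b)); ring.
Qed.

Lemma eq_of_close_eq (P Q : V -> R) a b x :
  {for x, continuous P} -> {for x, continuous Q} ->
  (forall h : R, 0 < h -> exists s t s' t',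
    [/\ 0 < s < h, 0 < t < h, 0 < s' < h, 0 < t' < h &
        P (x + s *: a + t *: b) = Q (x + s' *: a + t' *: b)]) ->
  P x = Q x.
Proof.
move=> cP cQ PQ.
apply/eqP; rewrite -subr_eq0 -normr_le0; apply/ler_addgt0Pr => e e0.
rewrite add0r.
have e2 : 0 < e / 2 by rewrite divr_gt0.
have /cvgrPdist_lt/(_ _ e2)/nbhs_ballP[r /= r0 HP] := cP.
have /cvgrPdist_lt/(_ _ e2)/nbhs_ballP[q /= q0 HQ] := cQ.
pose N := `|a| + `|b| + 1.
(* The summand 1 in [N] allows [a = b = 0] and makes [h * (|a| + |b|)] strictly less than
   [Num.min r q]. *)
have N0 : 0 < N by rewrite /N ltr_wpDl// addr_ge0.
pose h := Num.min r q / N.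
have h0 : 0 < h by rewrite divr_gt0// lt_min r0.
have near_x s t : 0 < s < h -> 0 < t < h ->
    `|x - (x + s *: a + t *: b)| < Num.min r q.
  move=> /andP[s0 sh] /andP[t0 th].
  rewrite -addrA opprD addrA subrr add0r normrN.
  apply: (le_lt_trans (ler_normD _ _)); rewrite !normrZ !gtr0_norm//.
  apply: (@le_lt_trans _ _ (h * (`|a| + `|b|))).
    by rewrite mulrDr lerD// ler_wpM2r// ltW.
  by rewrite -[ltRHS](divfK (lt0r_neq0 N0)) -/h ltr_pM2l// /N ltrDl.
have [s [t [s' [t' [sh th sh' th' E]]]]] := PQ h h0.
have := HP (x + s *: a + t *: b); have := HQ (x + s' *: a + t' *: b).
rewrite -!ball_normE /ball_ /= -E => {}HQ {}HP.
have {}HP : `|P x - P (x + s *: a + t *: b)| < e / 2.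
  by apply: HP; apply: lt_le_trans (near_x _ _ sh th) _; rewrite ge_min lexx.
have {}HQ : `|Q x - P (x + s *: a + t *: b)| < e / 2.
  apply: HQ; apply: lt_le_trans (near_x _ _ sh' th') _.
  by rewrite ge_min lexx orbT.
apply/ltW/(le_lt_trans (ler_distD (P (x + s *: a + t *: b)) _ _)).
by rewrite (splitr e) ltrD// distrC.
Qed.

(** Schwarz's theorem: for each [h], both mixed derivatives, taken at suitable points near [x],
    equal the same second difference divided by [h * h]; continuity carries the equality to [x]. *)
Lemma derive_comm f a b x :
  (forall y, derivable f y a) -> (forall y, derivable f y b) ->
  (forall y, derivable ('D_a f) y b) -> (forall y, derivable ('D_b f) y a) ->
  {for x, continuous ('D_b ('D_a f))} -> {for x, continuous ('D_a ('D_b f))} ->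
  'D_b ('D_a f) x = 'D_a ('D_b f) x.
Proof.
move=> fa fb fab fba ca cb; apply: (eq_of_close_eq ca cb (a := a) (b := b)).
move=> h h0.
have [s [t [sh th E1]]] := MVT_mixed x h0 fa fab.
have [t' [s' [th' sh' E2]]] := MVT_mixed x h0 fb fba.
exists s, t, s', t'; split; [exact: sh|exact: th|exact: sh'|exact: th'|].
apply: (mulIf (lt0r_neq0 h0)); apply: (mulIf (lt0r_neq0 h0)).
apply: etrans (esym E1) _; rewrite (addrAC x (s' *: a)); apply: etrans _ E2.
by rewrite (addrAC x (h *: b)); congr (_ + _); exact: addrAC.
Qed.

End Schwarz.

(** * Determinants of a matrix with a row replaced *)

Section SetRow.
Context {R : comNzRingType} {n : nat}.
Implicit Types (A : 'M[R]_n) (u : 'rV[R]_n).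

Definition set_row A i u : 'M[R]_n :=
  \matrix_(k, l) if k == i then u 0 l else A k l.

Lemma cofactor_set_row A i u j : cofactor (set_row A i u) i j = cofactor A i j.
Proof.
rewrite /cofactor; congr (_ * \det _); apply/matrixP => k l.
by rewrite !mxE eq_sym (negbTE (neq_lift _ _)).
Qed.

Lemma det_set_row_delta A i j :
  \det (set_row A i (delta_mx 0 j)) = cofactor A i j.
Proof.
rewrite (expand_det_row _ i) (bigD1 j)//= big1 => [|l lj].
  by rewrite !mxE !eqxx mul1r cofactor_set_row addr0.
by rewrite !mxE eqxx (negbTE lj) mul0r.
Qed.

Lemma det_set_row0 A i : \det (set_row A i 0) = 0.
Proof.
by rewrite (expand_det_row _ i) big1// => l _; rewrite !mxE eqxx mul0r.
Qed.

Lemma det_set_row_swap A i k u w : i != k ->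
  \det (set_row (set_row A k u) i w) = - \det (set_row (set_row A i u) k w).
Proof.
(* The boolean [i != k] is the parity of [tperm i k], so the sign becomes the determinant of a
   permutation matrix. *)
move=> ik; rewrite -[RHS]mulN1r -[-1]/((-1) ^+ true) -[true]ik -odd_tperm.
rewrite -det_perm -det_mulmx -[perm_mx _ *m _]xrowE; congr (\det _).
apply/matrixP => p l; rewrite !mxE; case: tpermP => [->|->|/eqP pi /eqP pk].
- by rewrite !eqxx.
- by rewrite !eqxx eq_sym (negbTE ik).
- by rewrite (negbTE pi) (negbTE pk).
Qed.

End SetRow.

(** * Differentiating a determinant row by row *)

Section DeriveDet.
Context {R : realType} {V : normedModType R}.

Lemma is_derive_prod n (f : 'I_n -> V -> R) (df : 'I_n -> R) (x w : V) :
  (forall i, is_derive x w (f i) (df i)) ->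
  is_derive x w (fun y => \prod_i f i y)
    (\sum_k \prod_i (if i == k then df i else f i x)).
Proof.
elim: n f df => [|n IH] f df fd.
  under eq_fun do rewrite big_ord0.
  by rewrite big_ord0; exact: is_derive_cst.
under eq_fun do rewrite big_ord_recl.
have := is_deriveM (fd ord0) (IH _ _ (fun i => fd (lift ord0 i))).
move=> /is_derive_eq; apply.
rewrite addrC big_ord_recl big_ord_recl /= /GRing.scale /=; congr (_ + _).
  by rewrite mulrC; congr (_ * _).
rewrite mulr_sumr; apply: eq_bigr => k _.
by rewrite big_ord_recl /=.
Qed.

(** The product rule is applied to each term of the Leibniz expansion; exchanging the two sums then
    collects, for each [k], the terms in which row [k] is differentiated. *)
Lemma is_derive_det n (N : V -> 'M[R]_n) (dN : 'M[R]_n) (x w : V) :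
  (forall k l, is_derive x w (fun y => N y k l) (dN k l)) ->
  is_derive x w (fun y => \det (N y))
    (\sum_k \det (set_row (N x) k (row k dN))).
Proof.
move=> Nd.
have -> : (fun y => \det (N y)) =
    \sum_(s : 'S_n) ((-1) ^+ s \*: (fun y => \prod_i N y i (s i))).
  by apply/funext => y; rewrite fct_sumE.
have -> : \sum_k \det (set_row (N x) k (row k dN)) =
    \sum_(s : 'S_n) (-1) ^+ s *:
      \sum_k \prod_i (if i == k then dN i (s i) else N x i (s i)).
  rewrite exchange_big; apply: eq_bigr => s _.
  rewrite scaler_sumr; apply: eq_bigr => k _; congr (_ * _).
  by apply: eq_bigr => i _; rewrite !mxE; case: eqP => // ->.
elim/big_ind2 : _ => [|*|s _]; [exact: is_derive_cst|exact: is_deriveD|].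
by apply: is_deriveZ; apply: is_derive_prod => i.
Qed.

End DeriveDet.

(** Exchanging the two summations shows that the sum is its own opposite. *)
Lemma sum_antisym (R : numDomainType) (I : finType) (T : I -> I -> R) :
  (forall i k, T k i = - T i k) -> \sum_i \sum_k T i k = 0.
Proof.
move=> TN; apply/eqP; rewrite -eqNr [eqbRHS]exchange_big -sumrN; apply/eqP.
by apply: eq_bigr => i _; rewrite -sumrN; apply: eq_bigr => k _; rewrite [RHS]TN.
Qed.

Lemma scale_det_invmx (R : comUnitRingType) n (A : 'M[R]_n) :
  A \in unitmx -> \det A *: invmx A = \adj A.
Proof. by move=> uA; rewrite /invmx uA scalerA divrr// scale1r. Qed.

Theorem proposition1 (R : realType) (d : nat) (hd : (1 <= d)%N)
    (v : 'cV[R]_d -> 'cV[R]_d)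
    (hv : classCv 2 v)
    (hinv : forall x : 'cV[R]_d, 1%:M + nablaT v x \in unitmx) :
  let A := fun x : 'cV[R]_d =>
    \det (1%:M + nablaT v x) *: (invmx (1%:M + nablaT v x))^T in
  forall x : 'cV[R]_d, row_nabla_defined A x /\ row_nabla A x = 0.
Proof.
move=> A x.
pose M y := 1%:M + nablaT v y.
(* [H i] is the entrywise derivative of [M] at [x] along the [i]-th axis. *)
pose H i : 'M[R]_d :=
  \matrix_(k, l) partial i (partial k (fun y => v y l 0)) x.
have HC i k l : H i k l = H k i l.
  have [_ vl] := hv l; have [vi [_ vi']] := vl i; have [vk [_ vk']] := vl k.
  have [vki [cki _]] := vk' i; have [vik [cik _]] := vi' k.
  rewrite [LHS]mxE [RHS]mxE.
  exact: (derive_comm vk vi vki vik (cki x) (cik x)).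
have MH i k l : is_derive x (delta_mx i 0) (fun y => M y k l) (H i k l).
  have -> : (fun y => M y k l) =
      cst ((1%:M : 'M[R]_d) k l) + partial k (fun y => v y l 0).
    by apply/funext => y; rewrite !mxE.
  have [_ /(_ k)[_ [_ /(_ i)[vki _]]]] := hv l.
  rewrite -[H i k l]add0r; apply: is_deriveD.
  by rewrite mxE; apply: DeriveDef => //; exact: vki.
clearbody H.
have AE i j :
    (fun y => A y i j) = fun y => \det (set_row (M y) i (delta_mx 0 j)).
  apply/funext => y.
  by rewrite det_set_row_delta /A -linearZ/= scale_det_invmx ?hinv// !mxE.
(* Row [i] of the differentiated matrix is the constant [delta_mx 0 j], so its derivative is [H i]
   with row [i] set to zero. *)
pose T j i k := \det (set_row (set_row (M x) i (delta_mx 0 j)) k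
                              (row k (set_row (H i) i 0))).
have dA i j : is_derive x (delta_mx i 0) (fun y => A y i j) (\sum_k T j i k).
  rewrite AE; apply: is_derive_det => k l.
  have [->|ki] := eqVneq k i.
    rewrite mxE eqxx mxE.
    under eq_fun do rewrite mxE eqxx.
    exact: is_derive_cst.
  rewrite mxE (negbTE ki).
  under eq_fun do rewrite mxE (negbTE ki).
  exact: MH.
split=> [i j|]; first exact: (@ex_derive _ _ _ _ _ _ _ (dA i j)).
apply/rowP => j; rewrite !mxE.
under eq_bigr do rewrite /partial (@derive_val _ _ _ _ _ _ _ (dA _ j)).
apply: sum_antisym => i k; rewrite /T.
have row0 p : row p (set_row (H p) p 0) = 0.
  by apply/rowP => l; rewrite !mxE eqxx.
(* The diagonal terms vanish because they contain a zero row. *)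
have [->|ik] := eqVneq i k; first by rewrite row0 det_set_row0 oppr0.
(* By [HC] the terms for [(i, k)] and [(k, i)] insert the same row of second derivatives, so they
   differ by a row exchange. *)
have -> : row i (set_row (H k) k 0) = row k (set_row (H i) i 0).
  by apply/rowP => l; rewrite !mxE (negbTE ik) eq_sym (negbTE ik) HC.
exact: det_set_row_swap ik.
Qed.
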